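(* In general, for $A,B\in\mathbb{M}_n$ there do not exist unitaries $U,V\in\mathbb{M}_n$ such that $$|A+B|_{\mathrm{sym}}\le U|A|_{\mathrm{sym}}U^*+V|B|_{\mathrm{sym}}V^*;$$ that is, there exist $n\ge 1$ and $A,B\in\mathbb{M}_n$ for which no such pair of unitaries exists. Indeed, there exist $A,B\in\mathbb{M}_2$ such that $$\bigl\||A+B|_{\mathrm{sym}}\bigr\|_{\infty}>\bigl\||A|_{\mathrm{sym}}\bigr\|_{\infty}+\bigl\||B|_{\mathrm{sym}}\bigr\|_{\infty}.$$
   Context: $\mathbb{M}_n$ is the space of $n\times n$ complex matrices; $\|\cdot\|_\infty$ is the spectral (operator) norm. For $Z\in\mathbb{M}_n$, $|Z|=(Z^*Z)^{1/2}$, and the arithmetic symmetric modulus is $|Z|_{\mathrm{sym}}=\frac{|Z|+|Z^*|}{2}$. For Hermitian matrices, $X\le Y$ means $Y-X$ is positive semidefinite. *)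

(* Defs.v *)
From HB Require Import structures.
From mathcomp Require Import all_boot all_order all_algebra.
From mathcomp Require Import complex.
From mathcomp Require Import boolp classical_sets reals.

Set Implicit Arguments.
Unset Strict Implicit.
Unset Printing Implicit Defensive.

Import Order.TTheory GRing.Theory Num.Theory.

Local Open Scope classical_set_scope.
Local Open Scope ring_scope.
Local Open Scope sesquilinear_scope.

(* `M ^t*` is the conjugate transpose; the order on a numClosedFieldType makes
   `0 <= z` mean that z is real and nonnegative. *)
Definition psdmx (C : numClosedFieldType) (n : nat) (A : 'M[C]_n) : Prop :=
  A \is hermsymmx /\ forall v : 'cV[C]_n, 0 <= (v ^t* *m A *m v) 0 0.

Definition loewner_le (C : numClosedFieldType) (n : nat) (X Y : 'M[C]_n) : Prop :=
  psdmx (Y - X).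

(* Square root by the spectral functional calculus. On positive semidefinite
   matrices it is the unique positive semidefinite square root: see
   psdmx_sqrtmx, sqrtmxK and sqrtmx_unique. *)
Definition sqrtmx (C : numClosedFieldType) (n : nat) (A : 'M[C]_n) : 'M[C]_n :=
  invmx (spectralmx A) *m diag_mx (map_mx sqrtC (spectral_diag A))
    *m spectralmx A.

Definition modmx (C : numClosedFieldType) (n : nat) (Z : 'M[C]_n) : 'M[C]_n :=
  sqrtmx (Z ^t* *m Z).

Definition symmodmx (C : numClosedFieldType) (n : nat) (Z : 'M[C]_n) : 'M[C]_n :=
  2^-1 *: (modmx Z + modmx (Z ^t*)).

Definition l2norm (R : realType) (n : nat) (v : 'cV[R[i]]_n) : R :=
  Num.sqrt (\sum_i Normc.normc (v i 0) ^+ 2).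

(* The supremum is over a nonempty bounded set (has_sup_opnorm), so `sup` does
   not take its default value. *)
Definition opnorm (R : realType) (n : nat) (A : 'M[R[i]]_n) : R :=
  sup [set l2norm (A *m v) | v in [set v | l2norm v <= 1]].

Section PositiveSquareRoot.
Variables (C : numClosedFieldType) (n : nat).
Implicit Types A P Q X : 'M[C]_n.

Lemma hermsymmxP A : A \is hermsymmx <-> A = A ^t*.
Proof.
split=> [/is_hermitianmxP|eA]; first by rewrite expr0 scale1r.
by apply/is_hermitianmxP; rewrite expr0 scale1r.
Qed.

Lemma trmxC_mul m p q (A : 'M[C]_(m, p)) (B : 'M[C]_(p, q)) :
  (A *m B) ^t* = B ^t* *m A ^t*.
Proof. by rewrite trmx_mul map_mxM. Qed.

Lemma psdmx_gram (Z : 'M[C]_n) : psdmx (Z ^t* *m Z).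
Proof.
split; first by apply/hermsymmxP; rewrite trmxC_mul trmxCK.
move=> v; rewrite mulmxA -trmxC_mul -mulmxA !mxE sumr_ge0 // => i _.
by rewrite !mxE mulrC; exact: mul_conjC_ge0.
Qed.

Lemma psdmx_conj P X : psdmx X -> psdmx (P ^t* *m X *m P).
Proof.
case=> /hermsymmxP hX pX; split.
  by apply/hermsymmxP; rewrite !trmxC_mul trmxCK -hX mulmxA.
by move=> v; have := pX (P *m v); rewrite trmxC_mul !mulmxA.
Qed.

Lemma psdmx_diag (d : 'rV[C]_n) :
  psdmx (diag_mx d) <-> forall i, 0 <= d 0 i.
Proof.
split=> [[_ pd] i|d0].
  have := pd (delta_mx i 0); rewrite trmx_delta map_delta_mx -rowE.
  by rewrite -colE !mxE eqxx.
suff -> : diag_mx d =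
    (diag_mx (map_mx sqrtC d)) ^t* *m diag_mx (map_mx sqrtC d).
  exact: psdmx_gram.
rewrite tr_diag_mx map_diag_mx mulmx_diag; congr diag_mx.
apply/rowP => i; rewrite !mxE [X in X * _]geC0_conj ?sqrtC_ge0 //.
by rewrite -expr2 sqrtCK.
Qed.

Lemma psdmx_spectral A : psdmx A ->
  A = (spectralmx A) ^t* *m diag_mx (spectral_diag A) *m spectralmx A.
Proof.
case=> /hermitian_normalmx /orthomx_spectralP eA _.
by rewrite -invmx_unitary ?spectral_unitarymx.
Qed.

Lemma psdmx_spectral_ge0 A i : psdmx A -> 0 <= spectral_diag A 0 i.
Proof.
move=> pA; have eA := psdmx_spectral pA.
have uP := spectral_unitarymx A.
have : psdmx (diag_mx (spectral_diag A)).
  have := psdmx_conj ((spectralmx A) ^t*) pA.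
  rewrite trmxCK; move: (spectralmx A) uP (spectral_diag A) eA => U uU d ->.
  by rewrite !mulmxA (unitarymxP uU) mul1mx -mulmxA (unitarymxP uU) mulmx1.
by move=> /psdmx_diag.
Qed.

Lemma psdmx_sqrtmx A : psdmx A -> psdmx (sqrtmx A).
Proof.
move=> pA; rewrite /sqrtmx invmx_unitary ?spectral_unitarymx //.
apply/psdmx_conj/psdmx_diag => i.
by rewrite mxE sqrtC_ge0 psdmx_spectral_ge0.
Qed.

Lemma sqrtmxK A : psdmx A -> sqrtmx A *m sqrtmx A = A.
Proof.
move=> pA; rewrite /sqrtmx !mulmxA mulmxK ?spectral_unit //.
rewrite -(mulmxA (invmx _)) mulmx_diag invmx_unitary ?spectral_unitarymx //.
rewrite [RHS](psdmx_spectral pA); congr (_ *m diag_mx _ *m _).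
by apply/rowP => i; rewrite !mxE -expr2 sqrtCK.
Qed.

Lemma psdmx_sqr_inj P Q : psdmx P -> psdmx Q -> P *m P = Q *m Q -> P = Q.
Proof.
move=> pP pQ ePQ.
have eP := psdmx_spectral pP; have eQ := psdmx_spectral pQ.
have uP := spectral_unitarymx P; have uQ := spectral_unitarymx Q.
have dP i := psdmx_spectral_ge0 i pP; have dQ i := psdmx_spectral_ge0 i pQ.
move: eP eQ uP uQ dP dQ.
move: (spectralmx P) (spectralmx Q) (spectral_diag P) (spectral_diag Q).
move=> U V d e eP eQ uU uV d0 e0.
have UK : U *m U ^t* = 1%:M by exact/unitarymxP.
have VK : V *m V ^t* = 1%:M by exact/unitarymxP.
have KU : U ^t* *m U = 1%:M by exact: mulmx1C.
have KV : V ^t* *m V = 1%:M by exact: mulmx1C.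
have PU : P *m U ^t* = U ^t* *m diag_mx d.
  by rewrite eP -!mulmxA UK mulmx1.
have VQ : V *m Q = diag_mx e *m V.
  by rewrite eQ !mulmxA VK mul1mx.
pose W := V *m U ^t*.
have eW2 : diag_mx e *m (diag_mx e *m W) = W *m diag_mx d *m diag_mx d.
  have -> : diag_mx e *m (diag_mx e *m W) = V *m (Q *m Q) *m U ^t*.
    by rewrite /W !mulmxA VQ -(mulmxA _ V Q) VQ !mulmxA.
  by rewrite -ePQ /W -!mulmxA PU (mulmxA P) PU !mulmxA.
have eW : diag_mx e *m W = W *m diag_mx d.
  move: eW2; rewrite !mul_diag_mx !mul_mx_diag => /matrixP eW2.
  apply/matrixP => i j; have := eW2 i j; rewrite !mxE.
  set w := \sum_k _; have [->|w0] := eqVneq w 0; first by rewrite !(mul0r, mulr0).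
  rewrite -mulrA mulrA [_ * w]mulrC => /(mulfI w0) ed.
  rewrite mulrC; congr (w * _); apply/eqP.
  by rewrite -(@eqrXn2 _ 2) ?e0 ?d0 // !expr2 ed.
have : V ^t* *m (diag_mx e *m W) *m U = V ^t* *m (W *m diag_mx d) *m U.
  by rewrite eW.
rewrite /W !mulmxA -(mulmxA _ _ U) KU mulmx1 -eQ KV mul1mx -eP.
by move=> ->.
Qed.

Lemma sqrtmx_unique A P : psdmx P -> P *m P = A -> P = sqrtmx A.
Proof.
move=> pP <-; have pPP : psdmx (P *m P).
  by have := psdmx_gram P; case: (pP) => /hermsymmxP <-.
by apply: psdmx_sqr_inj; rewrite ?sqrtmxK //; exact: psdmx_sqrtmx.
Qed.

End PositiveSquareRoot.

Section OperatorNorm.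
Variables (R : realType) (n : nat).
Implicit Types (A : 'M[R[i]]_n) (v : 'cV[R[i]]_n).

Lemma normc_ge0 (z : R[i]) : 0 <= Normc.normc z.
Proof. by case: z => a b; exact: sqrtr_ge0. Qed.

Lemma normc_le_l2norm v i : Normc.normc (v i 0) <= l2norm v.
Proof.
rewrite -(ger0_norm (normc_ge0 _)) -sqrtr_sqr ler_wsqrtr // (bigD1 i) //=.
by rewrite lerDl sumr_ge0 // => j _; exact: sqr_ge0.
Qed.

Lemma has_sup_opnorm A :
  has_sup [set l2norm (A *m v) | v in [set v | l2norm v <= 1]].
Proof.
split.
  exists (l2norm (A *m 0)); exists 0 => //=.
  rewrite /l2norm big1 ?sqrtr0 // => i _.
  by rewrite mxE Normc.normc0 expr0n.
exists (Num.sqrt (\sum_i (\sum_j Normc.normc (A i j)) ^+ 2)) => _ [v /= v1 <-].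
rewrite ler_wsqrtr //; apply: ler_sum => i _.
rewrite lerXn2r ?nnegrE ?normc_ge0 ?sumr_ge0 // => [j _|].
  exact: normc_ge0.
rewrite mxE.
apply: (le_trans (y := \sum_j Normc.normc (A i j * v j 0))).
  elim/big_ind2: _ => [|x y z t hx hz|//]; first by rewrite Normc.normc0.
  by rewrite (le_trans (le_normcD _ _)) // lerD.
apply: ler_sum => j _; rewrite Normc.normcM ler_piMr ?normc_ge0 //.
exact: le_trans (normc_le_l2norm v j) v1.
Qed.

End OperatorNorm.

(* Main.v *)
Require Import Defs.
From mathcomp Require Import all_boot all_order all_algebra.
From mathcomp Require Import complex reals.
From mathcomp Require Import boolp classical_sets.
From mathcomp Require Import ring lra.

(** A real 2x2 matrix acts on the plane C as z |-> alpha z + beta z^*.  If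
    |alpha| >= |beta|, then |Z|_sym has norm
    |alpha| + |beta| |Re alpha| / |alpha|, which is not convex in
    (alpha, beta).  The counterexample adds alpha = 60 + 45i, beta = 0, with
    |A|_sym = 75 I, to the nilpotent alpha = 35i, beta = 35i, with
    |B|_sym = 35 I.  The sum has |alpha| = 100, |beta| = 35 and Re alpha = 60,
    hence norm 100 + 21 > 75 + 35.  Since |A|_sym and |B|_sym are scalar,
    conjugating them by unitaries changes nothing, so the same pair also
    refutes the operator inequality. *)

Set Implicit Arguments.
Unset Strict Implicit.
Unset Printing Implicit Defensive.

Import Order.TTheory GRing.Theory Num.Theory.

Local Open Scope ring_scope.
Local Open Scope sesquilinear_scope.

Section Matrix2.
Variable K : comNzRingType.
Implicit Types a b c d : K.

Definition mx2 a b c d : 'M[K]_2 :=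
  \matrix_(i, j) if i == 0 then (if j == 0 then a else b)
                 else (if j == 0 then c else d).

Lemma mx2_mul a b c d a' b' c' d' :
  mx2 a b c d *m mx2 a' b' c' d' =
  mx2 (a * a' + b * c') (a * b' + b * d') (c * a' + d * c') (c * b' + d * d').
Proof.
apply/matrixP => i j; rewrite !mxE !big_ord_recl big_ord0 !mxE /= addr0.
by case: (i == 0); case: (j == 0).
Qed.

Lemma mx2_add a b c d a' b' c' d' :
  mx2 a b c d + mx2 a' b' c' d' = mx2 (a + a') (b + b') (c + c') (d + d').
Proof. by apply/matrixP => i j; rewrite !mxE; do 2 case: ifP. Qed.

Lemma mx2_scale x a b c d :
  x *: mx2 a b c d = mx2 (x * a) (x * b) (x * c) (x * d).
Proof. by apply/matrixP => i j; rewrite !mxE; do 2 case: ifP. Qed.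

Lemma mx2_tr a b c d : (mx2 a b c d)^T = mx2 a c b d.
Proof. by apply/matrixP => i j; rewrite !mxE; do 2 case: ifP. Qed.

Lemma mx2_scalar a : a%:M = mx2 a 0 0 a.
Proof.
apply/matrixP => i j; rewrite !mxE.
by case: i j => [[|[|[]]]] // ? [[|[|[]]]].
Qed.

End Matrix2.

Section RealMatrix.
Variables (R : realType) (n : nat).
Implicit Types M P : 'M[R]_n.

Local Notation "M %:MC" := (map_mx (real_complex R) M) (at level 2).

Lemma trmxC_real m p (M : 'M[R]_(m, p)) : (M%:MC) ^t* = (M^T)%:MC.
Proof. by apply/matrixP => i j; rewrite !mxE; exact: conjc_real. Qed.

(** Positivity over [R[i]] is certified by an explicit real congruence to a nonnegative diagonal. *)
Lemma psdmx_real_conj_diag P (d : 'rV[R]_n) : (forall i, 0 <= d 0 i) ->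
  psdmx (P^T *m diag_mx d *m P)%:MC.
Proof.
move=> d0; rewrite !map_mxM map_diag_mx -trmxC_real.
by apply/psdmx_conj/psdmx_diag => i; rewrite mxE ler0c.
Qed.

(** Uniqueness of the positive square root turns computing a modulus into checking a guessed root,
    so [spectralmx] is never evaluated. *)
Lemma modmx_real M P : psdmx P%:MC -> P *m P = M^T *m M ->
  modmx M%:MC = P%:MC.
Proof.
move=> pP eP; apply/esym/sqrtmx_unique => //.
by rewrite trmxC_real -!map_mxM eP.
Qed.

Lemma symmodmx_real M P Q : psdmx P%:MC -> psdmx Q%:MC ->
  P *m P = M^T *m M -> Q *m Q = M *m M^T ->
  symmodmx M%:MC = (2^-1 *: (P + Q))%:MC.
Proof.
move=> pP pQ eP eQ; rewrite /symmodmx trmxC_real.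
rewrite (modmx_real pP eP) (modmx_real pQ) ?trmxK //.
by rewrite map_mxZ map_mxD fmorphV rmorph_nat.
Qed.

End RealMatrix.

Section OperatorNormBounds.
Variables (R : realType) (n : nat).

Lemma l2norm_ge0 (v : 'cV[R[i]]_n) : 0 <= l2norm v.
Proof. exact: sqrtr_ge0. Qed.

Lemma l2normZ (a : R) (v : 'cV[R[i]]_n) : 0 <= a ->
  l2norm (a%:C%C *: v) = a * l2norm v.
Proof.
move=> a0; rewrite /l2norm -[in RHS](ger0_norm a0) -sqrtr_sqr -sqrtrM ?sqr_ge0 //.
congr Num.sqrt; rewrite mulr_sumr; apply: eq_bigr => i _.
rewrite mxE Normc.normcM exprMn; congr (_ * _).
by rewrite /= expr0n addr0 sqr_sqrtr ?sqr_ge0.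
Qed.

(** An inequality, since equality fails for [n = 0] and [a > 0]. *)
Lemma opnorm_scalar_le (a : R) : 0 <= a -> opnorm (a%:C%C%:M : 'M_n) <= a.
Proof.
move=> a0; apply: ge_sup; first by case: (has_sup_opnorm (a%:C%C%:M : 'M_n)).
by move=> _ [v /= v1 <-]; rewrite mul_scalar_mx l2normZ // ler_piMr.
Qed.

Lemma opnorm_ge (A : 'M[R[i]]_n) v : l2norm v <= 1 -> l2norm (A *m v) <= opnorm A.
Proof.
move=> v1; apply: ub_le_sup; first by case: (has_sup_opnorm A).
by exists v.
Qed.

End OperatorNormBounds.

Lemma conj_unitary_scalar (C : numClosedFieldType) n (U : 'M[C]_n) (a : C) :
  U \is unitarymx -> U *m a%:M *m U ^t* = a%:M.
Proof.
by move=> /unitarymxP uU; rewrite mul_mx_scalar -scalemxAl uU scalemx1.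
Qed.

Section Counterexample.
Variable R : realType.

Local Notation "M %:MC" := (map_mx (real_complex R) M) (at level 2).

Definition rotA : 'M[R[i]]_2 := (mx2 60 (-45) 45 60)%:MC.
Definition nilB : 'M[R[i]]_2 := (mx2 0 0 70 0)%:MC.

(** The matrix is [d] times the rank-one square of (p, q) plus [e] times that of (r, s). The vectors
    are not normalised, which keeps certificates rational. *)
Lemma psdmx_real2 (p q r s d e : R) : 0 <= d -> 0 <= e ->
  psdmx (mx2 (p * d * p + r * e * r) (p * d * q + r * e * s)
             (q * d * p + s * e * r) (q * d * q + s * e * s))%:MC.
Proof.
move=> d0 e0.
have := @psdmx_real_conj_diag R 2 (mx2 p q r s)
  (\row_j if j == 0 then d else e).
have -> : diag_mx (\row_j if j == 0 then d else e) = mx2 d 0 0 e :> 'M_2.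
  apply/matrixP => i j; rewrite !mxE.
  by case: i j => [[|[|[]]]] // ? [[|[|[]]]].
rewrite mx2_tr !mx2_mul !mulr0 !addr0 !add0r; apply.
by move=> i; rewrite mxE; case: ifP.
Qed.

(** [rotA] is 75 times a rotation, as 60^2 + 45^2 = 75^2, so both moduli are 75 I. *)
Lemma symmodmx_rotA : symmodmx rotA = (75%:C)%C%:M.
Proof.
have p75 : psdmx (mx2 75 0 0 75)%:MC.
  have := @psdmx_real2 1 0 0 1 75 75 (ler0n _ _) (ler0n _ _).
  by congr psdmx; congr map_mx; congr mx2; ring.
rewrite (symmodmx_real p75 p75) ?mx2_tr ?mx2_mul; try by congr mx2; ring.
rewrite -map_scalar_mx mx2_scalar mx2_add mx2_scale; congr map_mx.
by congr mx2; field.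
Qed.

(** The two moduli are 70 times complementary coordinate projections, so their mean is scalar. *)
Lemma symmodmx_nilB : symmodmx nilB = (35%:C)%C%:M.
Proof.
have p1 : psdmx (mx2 70 0 0 0)%:MC.
  have := @psdmx_real2 1 0 0 1 70 0 (ler0n _ _) (lexx _).
  by congr psdmx; congr map_mx; congr mx2; ring.
have p2 : psdmx (mx2 0 0 0 70)%:MC.
  have := @psdmx_real2 1 0 0 1 0 70 (lexx _) (ler0n _ _).
  by congr psdmx; congr map_mx; congr mx2; ring.
rewrite (symmodmx_real p1 p2) ?mx2_tr ?mx2_mul; try by congr mx2; ring.
rewrite -map_scalar_mx mx2_scalar mx2_add mx2_scale; congr map_mx.
by congr mx2; field.
Qed.

Lemma symmodmx_rotA_nilB :
  symmodmx (rotA + nilB) = (mx2 100 21 21 100)%:MC.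
Proof.
(* |A+B| and |(A+B)^*| have eigenvalues 135 = 10 * 27/2 and 65 = 10 * 13/2. *)
have d0 : 0 <= 27 / 2 :> R by lra.
have e0 : 0 <= 13 / 2 :> R by lra.
have p1 : psdmx (mx2 128 21 21 72)%:MC.
  (* (3, 1) and (1, -3) are orthogonal eigenvectors of squared length 10, so each weight is an
     eigenvalue divided by 10. *)
  have := @psdmx_real2 3 1 1 (-3) _ _ d0 e0.
  by congr psdmx; congr map_mx; congr mx2; field.
have p2 : psdmx (mx2 72 21 21 128)%:MC.
  have := @psdmx_real2 1 3 3 (-1) _ _ d0 e0.
  by congr psdmx; congr map_mx; congr mx2; field.
rewrite /rotA /nilB -map_mxD mx2_add.
rewrite (symmodmx_real p1 p2) ?mx2_tr ?mx2_mul; try by congr mx2; ring.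
by rewrite mx2_add mx2_scale; congr map_mx; congr mx2; field.
Qed.

(** Squaring avoids the irrational factor sqrt 2 and leaves polynomial goals for [nra]. *)
Lemma l2norm_const2 (a : R) : l2norm (const_mx a%:C%C : 'cV_2) ^+ 2 = 2 * a ^+ 2.
Proof.
rewrite /l2norm sqr_sqrtr; last by apply: sumr_ge0 => i _; exact: sqr_ge0.
rewrite !big_ord_recl big_ord0 !mxE /= expr0n /= !addr0 sqr_sqrtr ?sqr_ge0 //.
ring.
Qed.

Lemma symmodmx_rotA_nilB_const (a : R) :
  symmodmx (rotA + nilB) *m (const_mx a%:C%C : 'cV_2) = const_mx (121 * a)%:C%C.
Proof.
have -> : const_mx a%:C%C = map_mx (real_complex R) (const_mx a) :> 'cV_2.
  by rewrite map_const_mx.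
rewrite symmodmx_rotA_nilB -map_mxM -map_const_mx; congr map_mx.
apply/matrixP => i j; rewrite !mxE !big_ord_recl big_ord0 !mxE /=.
by case: ifP => _; ring.
Qed.

Lemma opnorm_symmodmx_rotA_nilB : 110 < opnorm (symmodmx (rotA + nilB)).
Proof.
(* 7/10 is a rational value just below 1 / sqrt 2. The vector lies in the eigenspace for 121, and
   the loss is harmless: 2 * (121 * 7/10)^2 > 110^2. *)
have v1 : l2norm (const_mx (7 / 10)%:C%C : 'cV[R[i]]_2) <= 1.
  have v0 := l2norm_ge0 (const_mx (7 / 10)%:C%C : 'cV[R[i]]_2).
  have := l2norm_const2 (7 / 10 : R).
  by move: (l2norm _) v0 => x x0 x2; nra.
apply: lt_le_trans (opnorm_ge _ v1); rewrite symmodmx_rotA_nilB_const.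
have w0 := l2norm_ge0 (const_mx (121 * (7 / 10))%:C%C : 'cV[R[i]]_2).
have := l2norm_const2 (121 * (7 / 10) : R).
by move: (l2norm _) w0 {v1} => x x0 x2; nra.
Qed.

End Counterexample.

Theorem theorem1p8 (R : realType) :
  (exists (n : nat) (A B : 'M[R[i]]_n),
      (1 <= n)%N /\
      ~ (exists U V : 'M[R[i]]_n,
            [/\ U \is unitarymx, V \is unitarymx
              & loewner_le (symmodmx (A + B))
                  (U *m symmodmx A *m U ^t* + V *m symmodmx B *m V ^t*)]))
  /\
  (exists A B : 'M[R[i]]_2,
      opnorm (symmodmx (A + B)) > opnorm (symmodmx A) + opnorm (symmodmx B)).
Proof.
split.
  exists 2%N, (rotA R), (nilB R); split=> // -[U [V [uU uV [_ pUV]]]].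
  move: pUV; rewrite symmodmx_rotA symmodmx_nilB !conj_unitary_scalar //.
  (* At (1, 1) the quadratic form of the difference is 2 * 110 - 2 * 121 = -22, contradicting
     positivity. *)
  move=> /(_ (map_mx (real_complex R) (const_mx 1))).
  rewrite trmxC_real symmodmx_rotA_nilB -!(map_scalar_mx (real_complex R)).
  rewrite -map_mxD -map_mxB -!map_mxM !mx2_scalar mx2_add -scaleN1r mx2_scale mx2_add.
  rewrite [X in 0 <= X]mxE ler0c !mxE !big_ord_recl big_ord0.
  rewrite !mxE !big_ord_recl !big_ord0 !mxE /=; lra.
exists (rotA R), (nilB R).
have hA : opnorm (symmodmx (rotA R)) <= 75.
  by rewrite symmodmx_rotA; exact: opnorm_scalar_le.
have hB : opnorm (symmodmx (nilB R)) <= 35.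
  by rewrite symmodmx_nilB; exact: opnorm_scalar_le.
apply: le_lt_trans (lerD hA hB) _.
have -> : 75 + 35 = 110 :> R by rewrite -natrD.
exact: opnorm_symmodmx_rotA_nilB.
Qed.
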